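(* Let $q$ be a complex number with $|q|<1$ and let $a$ be a nonzero complex number such that no denominator below vanishes (i.e. $a\notin\{\pm q^{-1/2},\pm q^{-3/2},\pm q^{-5/2},\ldots\}$). Then $$\sum_{n\ge 0}\frac{(a;q)_n (a^{-1}q^2;q^2)_n}{(a^2 q;q^2)_n (q^3;q^3)_n}(-1)^n a^n q^{\binom{n}{2}+n} = \frac{(aq;q^2)_\infty (a^3q^3; q^6)_\infty}{(a^2 q; q^2)_\infty (q^3; q^6)_\infty}.$$
   Context: For $n\in\mathbb{N}\cup\{\infty\}$, the $q$-Pochhammer symbol is $(A;q)_n:=\prod_{k=0}^{n-1}(1-Aq^k)$ (with $(A;q)_0=1$). Note $(a^{-1}q^2;q^2)_n a^n=\prod_{k=1}^n(a-q^{2k})$, so the summand is well defined. *)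

(* Defs.v *)
From Stdlib Require Import Reals.
From Coquelicot Require Import Coquelicot.
Local Open Scope C_scope.

(* (A;q)_n = (1 - A) (1 - A q) ... (1 - A q^(n-1)) *)
Fixpoint qpoch (A q : C) (n : nat) : C :=
  match n with
  | O => 1
  | S k => qpoch A q k * (1 - A * q ^ k)
  end.

(* Coquelicot has no total limit operator for sequences of complex numbers, so
   the limit is taken on real and imaginary parts; [Clim_seq_unique] shows that
   it is the limit in C whenever that limit exists. *)
Definition Clim_seq (u : nat -> C) : C :=
  (real (Lim_seq (fun n => Re (u n))), real (Lim_seq (fun n => Im (u n)))).

Lemma Clim_seq_unique (u : nat -> C) (l : C) :
  filterlim u eventually (locally l) -> Clim_seq u = l.
Proof.
intros H; destruct l as [x y]; unfold Clim_seq.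
rewrite (is_lim_seq_unique (fun n => Re (u n)) x).
- rewrite (is_lim_seq_unique (fun n => Im (u n)) y); [reflexivity|].
  apply is_lim_seq_spec; intros eps.
  destruct (H (ball (x, y) eps)) as [N HN]; [exists eps; auto|].
  exists N; intros n Hn; apply (HN n Hn).
- apply is_lim_seq_spec; intros eps.
  destruct (H (ball (x, y) eps)) as [N HN]; [exists eps; auto|].
  exists N; intros n Hn; apply (HN n Hn).
Qed.

Definition qpoch_inf (A q : C) : C := Clim_seq (qpoch A q).

(* Main.v *)
Require Import Defs.
From Stdlib Require Import Reals Lra Lia.
From Coquelicot Require Import Coquelicot.
Local Open Scope C_scope.

(** Let F(x) denote the left-hand side with a = x, rewritten so that x = 0 is
    allowed.  A q-Zeilberger certificate telescopes
    (1 - x^2 q)(1 - x^2 q^3) F(x) - (1 - x q)(1 - x^3 q^3) F(x q^2) to 0.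
    Iterating this relation and letting x q^(2N) tend to 0 gives
    (x^2 q; q^2)_oo F(x) = (x q; q^2)_oo (x^3 q^3; q^6)_oo F(0).
    At x = 1 the series reduces to its first term, so that
    F(0) = 1 / (q^3; q^6)_oo. *)

(** * Convergence of complex sequences and series *)

(** Convergence is phrased through a real null sequence, so that the limit theorems for real
    sequences apply. *)
Definition Ccvg (u : nat -> C) (l : C) : Prop :=
  is_lim_seq (fun n => Cmod (u n - l)) 0.

Lemma CcvgP (u : nat -> C) (l : C) :
  Ccvg u l <->
  forall eps : R, (0 < eps)%R ->
  exists N, forall n, (N <= n)%nat -> (Cmod (u n - l) < eps)%R.
Proof.
unfold Ccvg; rewrite <- is_lim_seq_spec; split; intros H.
- intros eps He; destruct (H (mkposreal eps He)) as [N HN].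
  exists N; intros n Hn; specialize (HN n Hn); simpl in HN.
  rewrite Rminus_0_r, Rabs_pos_eq in HN; auto using Cmod_ge_0.
- intros [eps He]; destruct (H eps He) as [N HN]; exists N; intros n Hn; simpl.
  rewrite Rminus_0_r, Rabs_pos_eq; auto using Cmod_ge_0.
Qed.

Lemma Ccvg_filterlim (u : nat -> C) (l : C) :
  Ccvg u l <-> filterlim u eventually (@locally C_NormedModule l).
Proof.
rewrite CcvgP, filterlim_locally_ball_norm; split.
- intros H [eps He]; destruct (H eps He) as [N HN]; exists N; intros n Hn.
  apply (HN n Hn).
- intros H eps He; destruct (H (mkposreal eps He)) as [N HN]; exists N; intros n Hn.
  exact (HN n Hn).
Qed.

Lemma Ccvg_series (u : nat -> C) (l : C) :
  Ccvg (sum_n u) l <-> is_series u l.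
Proof. apply Ccvg_filterlim. Qed.

Lemma Ccvg_Clim_seq (u : nat -> C) (l : C) : Ccvg u l -> Clim_seq u = l.
Proof. intros H; apply Clim_seq_unique, Ccvg_filterlim, H. Qed.

Lemma Ccvg_dominated (u : nat -> C) (l : C) (e : nat -> R) :
  (forall n, (Cmod (u n - l) <= e n)%R) -> is_lim_seq e 0 -> Ccvg u l.
Proof.
intros H He; apply (is_lim_seq_le_le (fun _ => 0) _ e); auto.
- intros n; split; auto using Cmod_ge_0.
- apply is_lim_seq_const.
Qed.

Lemma Ccvg_unique (u : nat -> C) (l l' : C) : Ccvg u l -> Ccvg u l' -> l = l'.
Proof.
intros H H'; rewrite <- (Ccvg_Clim_seq _ _ H); apply Ccvg_Clim_seq, H'.
Qed.

Lemma Ccvg_ext (u v : nat -> C) (l : C) :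
  (forall n, u n = v n) -> Ccvg u l -> Ccvg v l.
Proof. intros H; apply is_lim_seq_ext; intros n; rewrite H; reflexivity. Qed.

Lemma Ccvg_const (c : C) : Ccvg (fun _ => c) c.
Proof.
apply (is_lim_seq_ext (fun _ => 0%R)); [|apply is_lim_seq_const].
intros n; replace (c - c) with (RtoC 0) by ring; symmetry; apply Cmod_0.
Qed.

Lemma Ccvg_subseq (u : nat -> C) (l : C) (f : nat -> nat) :
  (forall n, (n <= f n)%nat) -> Ccvg u l -> Ccvg (fun n => u (f n)) l.
Proof.
rewrite !CcvgP; intros Hf H eps He; destruct (H eps He) as [N HN].
exists N; intros n Hn; apply HN; specialize (Hf n); lia.
Qed.

Lemma Ccvg_incr_1 (u : nat -> C) (l : C) : Ccvg (fun n => u (S n)) l -> Ccvg u l.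
Proof. intros H; apply is_lim_seq_incr_1; exact H. Qed.

Lemma Ccvg_minus (u v : nat -> C) (l k : C) :
  Ccvg u l -> Ccvg v k -> Ccvg (fun n => u n - v n) (l - k).
Proof.
intros Hu Hv.
apply (Ccvg_dominated _ _ (fun n => Cmod (u n - l) + Cmod (v n - k))%R).
- intros n; replace (u n - v n - (l - k)) with ((u n - l) + - (v n - k)) by ring.
  rewrite <- (Cmod_opp (v n - k)); apply Cmod_triangle.
- replace (Finite 0) with (Finite (0 + 0)) by (f_equal; ring).
  apply is_lim_seq_plus'; assumption.
Qed.

Lemma Ccvg_mult (u v : nat -> C) (l k : C) :
  Ccvg u l -> Ccvg v k -> Ccvg (fun n => u n * v n) (l * k).
Proof.
intros Hu Hv.
apply (Ccvg_dominated _ _ (fun n => Cmod (u n - l) * Cmod (v n - k)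
   + Cmod l * Cmod (v n - k) + Cmod k * Cmod (u n - l))%R).
- intros n; replace (u n * v n - l * k)
    with ((u n - l) * (v n - k) + l * (v n - k) + k * (u n - l)) by ring.
  rewrite <- !Cmod_mult.
  eapply Rle_trans; [apply Cmod_triangle|]; apply Rplus_le_compat_r, Cmod_triangle.
- replace (Finite 0) with (Finite (0 * 0 + Cmod l * 0 + Cmod k * 0))
    by (f_equal; ring).
  repeat apply is_lim_seq_plus'; apply is_lim_seq_mult'; auto;
  apply is_lim_seq_const.
Qed.

Lemma Ccvg_Cmod (u : nat -> C) (l : C) :
  Ccvg u l -> is_lim_seq (fun n => Cmod (u n)) (Cmod l).
Proof.
intros H; apply is_lim_seq_spec; intros [eps He].
destruct (proj1 (CcvgP u l) H eps He) as [N HN]; exists N; intros n Hn; simpl.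
specialize (HN n Hn); eapply Rle_lt_trans; [|apply HN].
pose proof (Cmod_triangle (u n - l) l) as H1.
pose proof (Cmod_triangle (- (u n - l)) (u n)) as H2.
rewrite Cmod_opp in H2.
replace (u n - l + l) with (u n) in H1 by ring.
replace (- (u n - l) + u n) with l in H2 by ring.
apply Rabs_le; lra.
Qed.

Lemma Ccvg_inv (u : nat -> C) (l : C) :
  (forall n, u n <> 0) -> l <> 0 -> Ccvg u l -> Ccvg (fun n => / u n) (/ l).
Proof.
intros Hu Hl H; unfold Ccvg.
apply (is_lim_seq_ext (fun n => Cmod (u n - l) / (Cmod (u n) * Cmod l))%R).
- intros n; replace (/ u n - / l) with (- (u n - l) / (u n * l)) by (field; auto).
  rewrite Cmod_div, Cmod_opp, Cmod_mult; auto.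
  apply Cmult_neq_0; auto.
- replace (Finite 0) with (Finite (0 / (Cmod l * Cmod l))) by (f_equal; unfold Rdiv; ring).
  apply Cmod_gt_0 in Hl.
  apply is_lim_seq_div'; auto; [|nra].
  apply is_lim_seq_mult'; [apply Ccvg_Cmod; auto | apply is_lim_seq_const].
Qed.

Lemma ex_series_Cmod (u : nat -> C) (M : nat -> R) :
  (forall n, (Cmod (u n) <= M n)%R) -> ex_series M ->
  exists l, Ccvg (sum_n u) l.
Proof.
intros Hu HM.
destruct (@ex_series_le C_AbsRing C_CompleteNormedModule u M Hu HM) as [l Hl].
exists l; apply Ccvg_filterlim; exact Hl.
Qed.

Lemma sum_n_CS (u : nat -> C) (n : nat) : sum_n u (S n) = sum_n u n + u (S n).
Proof. apply (sum_Sn u n). Qed.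

Lemma Cmod_sum_n_tail (u : nat -> C) (M : nat -> R) (n k : nat) :
  (forall n, (Cmod (u n) <= M n)%R) ->
  (Cmod (sum_n u (n + k) - sum_n u n) <= sum_n M (n + k) - sum_n M n)%R.
Proof.
intros Hu; induction k as [|k IH].
- rewrite Nat.add_0_r; replace (sum_n u n - sum_n u n) with (RtoC 0) by ring.
  rewrite Cmod_0; lra.
- rewrite Nat.add_succ_r, sum_n_CS, (sum_Sn M); change plus with Rplus.
  replace (sum_n u (n + k) + u (S (n + k)) - sum_n u n)
    with ((sum_n u (n + k) - sum_n u n) + u (S (n + k))) by ring.
  eapply Rle_trans; [apply Cmod_triangle|].
  specialize (Hu (S (n + k))); lra.
Qed.

(** Obtained by letting [k] tend to infinity in the bound of [Cmod_sum_n_tail] for finite blocks. *)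
Lemma Cmod_series_tail (u : nat -> C) (M : nat -> R) (l : C) (LM : R) (n : nat) :
  (forall n, (Cmod (u n) <= M n)%R) -> is_series M LM -> Ccvg (sum_n u) l ->
  (Cmod (l - sum_n u n) <= LM - sum_n M n)%R.
Proof.
intros Hu HM Hl.
apply (is_lim_seq_le (fun k => Cmod (sum_n u (n + k) - sum_n u n))
  (fun k => sum_n M (n + k) - sum_n M n)%R (Cmod (l - sum_n u n))
  (LM - sum_n M n)%R).
- intros k; apply Cmod_sum_n_tail, Hu.
- apply Ccvg_Cmod, Ccvg_minus; [|apply Ccvg_const].
  apply (Ccvg_subseq (sum_n u) l (fun k => (n + k)%nat)); auto; intros; lia.
- apply is_lim_seq_minus'; [|apply is_lim_seq_const].
  apply (is_lim_seq_ext (fun k => sum_n M (k + n))).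
  { intros k; rewrite Nat.add_comm; reflexivity. }
  apply -> is_lim_seq_incr_n; exact HM.
Qed.

Lemma Ccvg_sum_n (u : nat -> nat -> C) (v : nat -> C) (k : nat) :
  (forall n, Ccvg (fun N => u N n) (v n)) ->
  Ccvg (fun N => sum_n (u N) k - sum_n v k) 0.
Proof.
intros H; replace (RtoC 0) with (sum_n v k - sum_n v k) by ring.
apply Ccvg_minus; [|apply Ccvg_const].
induction k as [|k IH].
- rewrite sum_O; apply (Ccvg_ext (fun N => u N 0%nat)); auto.
  intros N; rewrite sum_O; reflexivity.
- rewrite sum_n_CS; replace (sum_n v k + v (S k)) with (sum_n v k - (0 - v (S k))) by ring.
  apply (Ccvg_ext (fun N => sum_n (u N) k - (0 - u N (S k)))).
  { intros N; rewrite sum_n_CS; ring. }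
  apply Ccvg_minus, Ccvg_minus; auto using Ccvg_const.
Qed.

(** Tannery's theorem, that is, dominated convergence for series. Beyond a suitable [k] the tails of
    all [u N] and of [v] are below [eps / 3] by domination, and the finite head converges
    termwise. *)
Lemma Ccvg_series_Tannery (u : nat -> nat -> C) (v : nat -> C)
  (M : nat -> R) (F : nat -> C) (L : C) :
  (forall N n, (Cmod (u N n) <= M n)%R) -> ex_series M ->
  (forall n, Ccvg (fun N => u N n) (v n)) ->
  (forall N, Ccvg (sum_n (u N)) (F N)) -> Ccvg (sum_n v) L ->
  Ccvg F L.
Proof.
intros Hu [LM HM] Huv HF HL; apply CcvgP; intros eps He.
(* The domination passes to the termwise limit. *)
assert (Hv : forall n, (Cmod (v n) <= M n)%R).
{ intros n; apply (is_lim_seq_le (fun N => Cmod (u N n)) (fun _ => M n)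
    (Cmod (v n)) (M n)); auto using Ccvg_Cmod, is_lim_seq_const. }
assert (HM' : is_lim_seq (sum_n M) LM) by exact HM.
apply is_lim_seq_spec in HM'.
assert (He3 : (0 < eps / 3)%R) by lra.
destruct (HM' (mkposreal _ He3)) as [k Hk]; specialize (Hk k (le_n k)).
simpl in Hk; apply Rabs_def2 in Hk.
destruct (proj1 (CcvgP _ _) (Ccvg_sum_n u v k Huv) _ He3) as [N0 HN0].
exists N0; intros N HN; specialize (HN0 N HN).
pose proof (Cmod_series_tail _ _ _ _ k (Hu N) HM (HF N)) as H1.
pose proof (Cmod_series_tail _ _ _ _ k Hv HM HL) as H2.
replace (F N - L) with ((F N - sum_n (u N) k) + (sum_n (u N) k - sum_n v k - 0)
   + - (L - sum_n v k)) by ring.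
eapply Rle_lt_trans; [apply Cmod_triangle|]; rewrite Cmod_opp.
pose proof (Cmod_triangle (F N - sum_n (u N) k) (sum_n (u N) k - sum_n v k - 0)).
lra.
Qed.

(** * Bounds for the factors 1 - A q^k and convergence of infinite products *)

Lemma neq_1_sub (z : C) : z <> 1 -> 1 - z <> 0.
Proof. intros H; apply Cminus_eq_contra; auto. Qed.

Lemma Cmod_1_minus_le (z : C) : (Cmod (1 - z) <= 1 + Cmod z)%R.
Proof.
pose proof (Cmod_triangle 1 (- z)) as H; rewrite Cmod_1, Cmod_opp in H; exact H.
Qed.

Lemma Cmod_1_minus_ge (z : C) : (1 - Cmod z <= Cmod (1 - z))%R.
Proof.
pose proof (Cmod_triangle (1 - z) z) as H.
replace (1 - z + z) with (RtoC 1) in H by ring; rewrite Cmod_1 in H; lra.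
Qed.

Lemma Cmod_pow_lt_1 (q : C) (n : nat) :
  (Cmod q < 1)%R -> (Cmod (q ^ S n) < 1)%R.
Proof.
intros Hq; rewrite Cmod_pow; apply pow_lt_1_compat; [|lia].
split; auto using Cmod_ge_0.
Qed.

Lemma pow_eventually_small (c r eps : R) :
  (0 <= r < 1)%R -> (0 < eps)%R ->
  exists N, forall n, (N <= n)%nat -> (c * r ^ n <= eps)%R.
Proof.
intros Hr He.
assert (H : is_lim_seq (fun n => c * r ^ n)%R (c * 0)%R).
{ apply is_lim_seq_mult'; [apply is_lim_seq_const|].
  apply is_lim_seq_geom; rewrite Rabs_pos_eq; lra. }
apply is_lim_seq_spec in H; destruct (H (mkposreal eps He)) as [N HN].
exists N; intros n Hn; specialize (HN n Hn); simpl in HN.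
apply Rabs_def2 in HN; lra.
Qed.

(** From some [N] on, |A q^k| is at most 1/2 and so the factor has modulus at least 1/2. The
    finitely many earlier factors are nonzero and have a positive minimum modulus. *)
Lemma Cpow_factors_bounded_below (A q : C) :
  (Cmod q < 1)%R -> (forall k, A * q ^ k <> 1) ->
  exists m, (0 < m)%R /\ forall k, (m <= Cmod (1 - A * q ^ k))%R.
Proof.
intros Hq HA.
destruct (pow_eventually_small (Cmod A) (Cmod q) (1 / 2)) as [N HN];
  [split; auto using Cmod_ge_0 | lra |].
assert (H : forall n, exists m, (0 < m)%R /\
  forall k, (k < n)%nat -> (m <= Cmod (1 - A * q ^ k))%R).
{ induction n as [|n [m [Hm IH]]]; [exists 1%R; split; [lra|lia]|].
  exists (Rmin m (Cmod (1 - A * q ^ n))); split.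
  - apply Rmin_pos; auto; apply Cmod_gt_0, neq_1_sub, HA.
  - intros k Hk; destruct (Nat.eq_dec k n) as [->|Hkn]; [apply Rmin_r|].
    eapply Rle_trans; [apply Rmin_l|apply IH; lia]. }
destruct (H N) as [m [Hm Hk]]; exists (Rmin m (1 / 2)); split.
- apply Rmin_pos; lra.
- intros k; destruct (Nat.lt_ge_cases k N) as [Hlt|Hge].
  + eapply Rle_trans; [apply Rmin_l|auto].
  + eapply Rle_trans; [apply Rmin_r|].
    specialize (HN k Hge); rewrite <- Cmod_pow, <- Cmod_mult in HN.
    pose proof (Cmod_1_minus_ge (A * q ^ k)); lra.
Qed.

(** Uses 1 + y <= exp y and the geometric series. The sequence [p] is left abstract because both the
    moduli of the partial products and their reciprocals are bounded this way. *)
Lemma geometric_product_bounded (p : nat -> R) (c r : R) :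
  (0 <= c)%R -> (0 <= r < 1)%R -> p 0%nat = 1%R ->
  (forall n, (0 <= p n)%R) ->
  (forall n, (p (S n) <= p n * (1 + c * r ^ n))%R) ->
  forall n, (p n <= exp (c / (1 - r)))%R.
Proof.
intros Hc Hr Hp0 Hp HpS n.
(* The exponent is the partial sum c (1 + r + ... + r^(n-1)), a bound sharp enough for induction. *)
apply Rle_trans with (exp (c * (1 - r ^ n) / (1 - r))).
- induction n as [|n IH].
  + rewrite Hp0; simpl; replace (c * (1 - 1) / (1 - r))%R with 0%R by (field; lra).
    rewrite exp_0; lra.
  + eapply Rle_trans; [apply HpS|].
    replace (c * (1 - r ^ S n) / (1 - r))%R
      with (c * (1 - r ^ n) / (1 - r) + c * r ^ n)%R by (simpl; field; lra).
    rewrite exp_plus; apply Rmult_le_compat; auto.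
    * assert (0 <= c * r ^ n)%R by (apply Rmult_le_pos; auto; apply pow_le; lra); lra.
    * apply exp_ineq1_le.
- assert (Hexp : forall y z, (y <= z -> exp y <= exp z)%R).
  { intros y z [Hyz| ->]; [left; apply exp_increasing|right]; auto. }
  apply Hexp; unfold Rdiv; apply Rmult_le_compat_r.
  + left; apply Rinv_0_lt_compat; lra.
  + assert (0 <= r ^ n)%R by (apply pow_le; lra); nra.
Qed.

Lemma qpoch_neq_0 (A q : C) (n : nat) :
  (forall k, A * q ^ k <> 1) -> qpoch A q n <> 0.
Proof.
intros HA; induction n as [|n IH]; simpl.
- exact C1_nz.
- apply Cmult_neq_0; auto; apply neq_1_sub, HA.
Qed.

(** Telescoping gives (A;q)_(n+1) = 1 - sum_(k <= n) (A;q)_k A q^k. The partial products are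
    bounded, so this series is dominated by a geometric one. *)
Lemma qpoch_Ccvg (A q : C) :
  (Cmod q < 1)%R -> Ccvg (qpoch A q) (qpoch_inf A q).
Proof.
intros Hq; assert (Hr : (0 <= Cmod q < 1)%R) by (split; auto using Cmod_ge_0).
pose proof (geometric_product_bounded (fun n => Cmod (qpoch A q n))
  (Cmod A) (Cmod q) (Cmod_ge_0 A) Hr) as HB.
set (B := exp (Cmod A / (1 - Cmod q))) in HB.
assert (HBn : forall n, (Cmod (qpoch A q n) <= B)%R).
{ apply HB; auto using Cmod_ge_0; [apply Cmod_1|].
  intros n; simpl; rewrite Cmod_mult; apply Rmult_le_compat_l; [apply Cmod_ge_0|].
  rewrite <- Cmod_pow, <- Cmod_mult; apply Cmod_1_minus_le. }
destruct (ex_series_Cmod (fun n => qpoch A q n * (A * q ^ n))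
  (fun n => (B * Cmod A) * Cmod q ^ n)%R) as [l Hl].
- intros n; rewrite !Cmod_mult, Cmod_pow, Rmult_assoc.
  apply Rmult_le_compat_r; auto.
  apply Rmult_le_pos; [apply Cmod_ge_0|apply pow_le; lra].
- apply (ex_series_scal (V := R_NormedModule)), ex_series_geom; rewrite Rabs_pos_eq; lra.
- assert (H : Ccvg (qpoch A q) (1 - l)).
  { apply Ccvg_incr_1; eapply Ccvg_ext;
      [|apply (Ccvg_minus _ _ _ _ (Ccvg_const 1) Hl)].
    induction n as [|n IH]; [rewrite sum_O; simpl; ring|].
    rewrite sum_n_CS.
    change (qpoch A q (S (S n))) with (qpoch A q (S n) * (1 - A * q ^ S n)).
    rewrite <- IH at 1.
    replace (qpoch A q (S n)) with (1 - sum_n (fun n => qpoch A q n * (A * q ^ n)) n).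
    ring. }
  unfold qpoch_inf; rewrite (Ccvg_Clim_seq _ _ H); exact H.
Qed.

(* The reciprocals of the partial products stay bounded because
   1/(1 - z) = 1 + z/(1 - z). *)
Lemma qpoch_inf_neq_0 (A q : C) :
  (Cmod q < 1)%R -> (forall k, A * q ^ k <> 1) -> qpoch_inf A q <> 0.
Proof.
intros Hq HA; assert (Hr : (0 <= Cmod q < 1)%R) by (split; auto using Cmod_ge_0).
destruct (Cpow_factors_bounded_below A q Hq HA) as [m [Hm Hk]].
assert (Hc : (0 <= Cmod A / m)%R)
  by (apply Rdiv_le_0_compat; auto using Cmod_ge_0).
pose proof (geometric_product_bounded (fun n => / Cmod (qpoch A q n))%R
  (Cmod A / m) (Cmod q) Hc Hr) as HB.
set (B := exp (Cmod A / m / (1 - Cmod q))) in HB.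
assert (Hp : forall n, (0 < Cmod (qpoch A q n))%R)
  by (intros n; apply Cmod_gt_0, qpoch_neq_0, HA).
assert (HBn : forall n, (/ Cmod (qpoch A q n) <= B)%R).
{ apply HB; [simpl; rewrite Cmod_1; lra| |].
  - intros n; left; apply Rinv_0_lt_compat, Hp.
  - intros n; simpl; rewrite Cmod_mult, Rinv_mult.
    apply Rmult_le_compat_l; [left; apply Rinv_0_lt_compat, Hp|].
    assert (Hd : (0 < Cmod (1 - A * q ^ n))%R) by (specialize (Hk n); lra).
    assert (Hi : (/ Cmod (1 - A * q ^ n) <= / m)%R) by (apply Rinv_le_contravar; auto).
    apply Rle_trans with ((Cmod (1 - A * q ^ n) + Cmod (A * q ^ n)) / Cmod (1 - A * q ^ n))%R.
    + apply Rle_trans with (1 * / Cmod (1 - A * q ^ n))%R; [lra|].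
      apply Rmult_le_compat_r; [left; apply Rinv_0_lt_compat, Hd|].
      pose proof (Cmod_1_minus_ge (A * q ^ n)); lra.
    + replace ((Cmod (1 - A * q ^ n) + Cmod (A * q ^ n)) / Cmod (1 - A * q ^ n))%R
        with (1 + Cmod (A * q ^ n) * / Cmod (1 - A * q ^ n))%R by (field; lra).
      apply Rplus_le_compat_l; rewrite Cmod_mult, Cmod_pow.
      replace (Cmod A / m * Cmod q ^ n)%R with (Cmod A * Cmod q ^ n * / m)%R
        by (unfold Rdiv; ring).
      apply Rmult_le_compat_l; auto.
      apply Rmult_le_pos; [apply Cmod_ge_0|apply pow_le; lra]. }
assert (HB0 : (0 < B)%R) by apply exp_pos.
(* The lower bound [/ B] on the moduli of the partial products survives in the limit. *)
apply Cmod_gt_0; apply Rlt_le_trans with (/ B)%R; [apply Rinv_0_lt_compat; auto|].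
apply (is_lim_seq_le (fun _ => / B)%R (fun n => Cmod (qpoch A q n)) (/ B)%R
  (Cmod (qpoch_inf A q))).
- intros n; rewrite <- (Rinv_inv (Cmod (qpoch A q n))).
  apply Rinv_le_contravar; auto; apply Rinv_0_lt_compat, Hp.
- apply is_lim_seq_const.
- apply Ccvg_Cmod, qpoch_Ccvg, Hq.
Qed.

(** * The summand as a hypergeometric term *)

(* The summand of the theorem for x = a, as a hypergeometric term: in this form
   it also makes sense at x = 0. *)
Fixpoint term (q x : C) (n : nat) : C :=
  match n with
  | O => 1
  | S k => term q x k *
      (- ((1 - x * q ^ k) * (x - q ^ 2 * (q ^ k) ^ 2) * (q * q ^ k)) /
         ((1 - x ^ 2 * q * (q ^ k) ^ 2) * (1 - q ^ 3 * (q ^ k) ^ 3)))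
  end.

(** The power of [q] has the shape it takes in the denominator of [term]. The other denominator
    factor is nonzero as soon as |q| < 1. *)
Definition admissible (q x : C) : Prop :=
  forall k : nat, x ^ 2 * q * (q ^ k) ^ 2 <> 1.

Lemma Cpow_pow_comm (q : C) (m n : nat) : (q ^ m) ^ n = (q ^ n) ^ m.
Proof. rewrite <- !Cpow_mult_r, Nat.mul_comm; reflexivity. Qed.

Lemma Cpow_S_neq_1 (q : C) (n : nat) : (Cmod q < 1)%R -> q ^ S n <> 1.
Proof.
intros Hq E; pose proof (Cmod_pow_lt_1 q n Hq) as H.
rewrite E, Cmod_1 in H; lra.
Qed.

Lemma cube_factor_neq_1 (q : C) (k : nat) :
  (Cmod q < 1)%R -> q ^ 3 * (q ^ k) ^ 3 <> 1.
Proof.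
intros Hq; rewrite <- Cpow_mult_r, <- Cpow_add_r; apply (Cpow_S_neq_1 q _ Hq).
Qed.

(* Closes the side conditions of [field], which are hypotheses up to ring
   normalisation. *)
Ltac nonzero :=
  repeat split; auto; let E := fresh in intros E;
  match goal with H : _ <> RtoC 0 |- _ => solve [apply H; rewrite <- E; ring] end.

(** Both sides have the same ratio of consecutive terms: the new factor [a] turns 1 - a^(-1)
    q^(2n+2) into a - q^(2n+2). *)
Lemma term_summand (q a : C) (n : nat) :
  (Cmod q < 1)%R -> a <> 0 -> admissible q a ->
  (qpoch a q n * qpoch (/ a * q ^ 2) (q ^ 2) n)
  / (qpoch (a ^ 2 * q) (q ^ 2) n * qpoch (q ^ 3) (q ^ 3) n)
  * (- (1)) ^ n * a ^ n * q ^ (n * (n - 1) / 2 + n) = term q a n.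
Proof.
intros Hq Ha Hd; induction n as [|n IH].
- simpl; field; exact C1_nz.
(* Passing from [n] to [S n] raises the binomial exponent by [n] and the linear one by 1; the added
   [n * 2] comes out of the integer division exactly. *)
- assert (E : (S n * (S n - 1) / 2 + S n = n * (n - 1) / 2 + n + S n)%nat).
  { replace (S n * (S n - 1))%nat with (n * (n - 1) + n * 2)%nat by
      (destruct n; simpl; lia).
    rewrite Nat.div_add by lia; lia. }
  rewrite E, (Cpow_add_r q _ (S n)).
  assert (H1 : qpoch (a ^ 2 * q) (q ^ 2) n <> 0).
  { apply qpoch_neq_0; intros k; rewrite Cpow_pow_comm; apply Hd. }
  assert (H2 : qpoch (q ^ 3) (q ^ 3) n <> 0).
  { apply qpoch_neq_0; intros k; rewrite Cpow_pow_comm.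
    apply cube_factor_neq_1, Hq. }
  assert (H3 := neq_1_sub _ (Hd n)).
  assert (H4 := neq_1_sub _ (cube_factor_neq_1 q n Hq)).
  cbn [term qpoch]; rewrite <- IH.
  rewrite (Cpow_pow_comm q 2 n), (Cpow_pow_comm q 3 n), !(Cpow_S _ n).
  field; nonzero.
Qed.

(** * The shift from x to x q^2 and the telescoping sum *)

Lemma admissible_shift (q x : C) : admissible q x -> admissible q (x * q ^ 2).
Proof.
intros H k E; apply (H (k + 2)%nat); rewrite <- E, Cpow_add_r; ring.
Qed.

Lemma admissible_shift_n (q x : C) (n : nat) :
  admissible q x -> admissible q (x * (q ^ 2) ^ n).
Proof.
intros H; induction n as [|n IH].
- replace (x * (q ^ 2) ^ 0) with x by (simpl; ring); exact H.
- rewrite (Cpow_S _ n).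
  replace (x * (q ^ 2 * (q ^ 2) ^ n)) with (x * (q ^ 2) ^ n * q ^ 2) by ring.
  apply admissible_shift, IH.
Qed.

(** The products for x q^2 and x differ only in their end factors; 1 - x cancels against x - 1,
    which leaves the sign. Denominators are cleared because 1 - x q and x - q^(2n) may vanish. *)
Lemma term_shift (q x : C) (n : nat) :
  (Cmod q < 1)%R -> admissible q x ->
  term q (x * q ^ 2) n * ((1 - x * q) * (1 - x ^ 2 * q * (q ^ n) ^ 2)
    * (1 - x ^ 2 * q ^ 3 * (q ^ n) ^ 2) * (x - (q ^ n) ^ 2))
  = - (term q x n * ((q ^ n) ^ 2 * (1 - x * q ^ n) * (1 - x * q * q ^ n)
    * (1 - x ^ 2 * q) * (1 - x ^ 2 * q ^ 3))).
Proof.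
intros Hq Hd; induction n as [|n IH]; [simpl; ring|].
assert (H4 := neq_1_sub _ (cube_factor_neq_1 q n Hq)).
assert (H1 := neq_1_sub _ (Hd n)).
(* The denominator factor of the shifted term at index [n] is that of the original one at index n +
   2. *)
assert (H3 := neq_1_sub _ (Hd (S (S n)))).
cbn [term]; rewrite ?(Cpow_S q (S n)), ?(Cpow_S q n) in *.
set (Q := q ^ n) in *; set (t := term q x n) in *; set (t' := term q (x * q ^ 2) n) in *.
clearbody Q t t'.
(* The shifted ratio contains x q^2 - q^2 Q^2 = q^2 (x - Q^2), which supplies the factor needed by
   the induction hypothesis. *)
transitivity (t' * ((1 - x * q) * (1 - x ^ 2 * q * Q ^ 2) *
      (1 - x ^ 2 * q ^ 3 * Q ^ 2) * (x - Q ^ 2)) *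
   (- ((1 - x * q ^ 2 * Q) * q ^ 2 * (q * Q) * (x - q ^ 2 * Q ^ 2)) /
    ((1 - x ^ 2 * q * Q ^ 2) * (1 - q ^ 3 * Q ^ 3)))).
- field; nonzero.
- rewrite IH; field; nonzero.
Qed.

(* The right-hand side is the certificate found by the q-Zeilberger algorithm. *)
Lemma term_telescoping (q x : C) (n : nat) :
  (Cmod q < 1)%R -> admissible q x ->
  (1 - x ^ 2 * q) * (1 - x ^ 2 * q ^ 3) * sum_n (term q x) n
  - (1 - x * q) * (1 - x ^ 3 * q ^ 3) * sum_n (term q (x * q ^ 2)) n
  = (1 - x ^ 2 * q) * (1 - x ^ 2 * q ^ 3) * term q x n *
    (x * (1 - x * q ^ n) * (1 - x * q ^ 2 * q ^ n) * q * q ^ n /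
     ((1 - x ^ 2 * q * (q ^ n) ^ 2) * (1 - x ^ 2 * q * (q ^ S n) ^ 2))).
Proof.
intros Hq Hd; induction n as [|n IH].
- rewrite !sum_O; cbn [term].
  assert (H1 := neq_1_sub _ (Hd 0%nat)); assert (H2 := neq_1_sub _ (Hd 1%nat)).
  simpl in *; field; nonzero.
- rewrite !sum_n_CS.
  assert (H0 := neq_1_sub _ (cube_factor_neq_1 q n Hq)).
  assert (H1 := neq_1_sub _ (Hd n)); assert (H2 := neq_1_sub _ (Hd (S n)));
  assert (H3 := neq_1_sub _ (Hd (S (S n)))).
  assert (Hs := term_shift q x n Hq Hd).
  cbn [term]; rewrite ?(Cpow_S q (S n)), ?(Cpow_S q n) in *.
  set (Q := q ^ n) in *; set (t := term q x n) in *; set (t' := term q (x * q ^ 2) n) in *.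
  set (s := sum_n (term q x) n) in *;
  set (s' := sum_n (term q (x * q ^ 2)) n) in *.
  clearbody Q t t' s s'; change C in s, s'.
  assert (H2' : 1 - x ^ 2 * q ^ 3 * Q ^ 2 <> 0)
    by (intros E; apply H2; rewrite <- E; ring).
  assert (H3' : 1 - x ^ 2 * q ^ 5 * Q ^ 2 <> 0)
    by (intros E; apply H3; rewrite <- E; ring).
  (* Expresses the new shifted term, times 1 - x q, through [t]. Its factor q^2 (x - Q^2) makes the
     left side of [Hs] appear, so that no division by 1 - x q or x - Q^2 occurs. *)
  assert (Et : (1 - x * q) * (t' *
      (- ((1 - x * q ^ 2 * Q) * (x * q ^ 2 - q ^ 2 * Q ^ 2) * (q * Q)) /
       ((1 - (x * q ^ 2) ^ 2 * q * Q ^ 2) * (1 - q ^ 3 * Q ^ 3))))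
    = t * (Q ^ 2 * (1 - x * Q) * (1 - x * q * Q) * (1 - x ^ 2 * q)
        * (1 - x ^ 2 * q ^ 3)) * ((1 - x * q ^ 2 * Q) * q ^ 3 * Q) /
      ((1 - x ^ 2 * q * Q ^ 2) * (1 - x ^ 2 * q ^ 3 * Q ^ 2)
       * (1 - x ^ 2 * q ^ 5 * Q ^ 2) * (1 - q ^ 3 * Q ^ 3))).
  { transitivity (t' * ((1 - x * q) * (1 - x ^ 2 * q * Q ^ 2) *
        (1 - x ^ 2 * q ^ 3 * Q ^ 2) * (x - Q ^ 2)) *
      (- ((1 - x * q ^ 2 * Q) * q ^ 3 * Q) /
      ((1 - x ^ 2 * q * Q ^ 2) * (1 - x ^ 2 * q ^ 3 * Q ^ 2)
       * (1 - x ^ 2 * q ^ 5 * Q ^ 2) * (1 - q ^ 3 * Q ^ 3)))).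
    - field; nonzero.
    - rewrite Hs; field; nonzero. }
  clear Hs; set (r' := t' * _) in *; clearbody r'.
  (* Splits off the induction hypothesis and groups 1 - x q with the new shifted term, as in
     [Et]. *)
  match goal with |- ?A * (s + ?r) - ?b * ?c * (s' + r') = _ =>
    transitivity ((A * s - b * c * s') + A * r - c * (b * r')) end; [ring|].
  rewrite IH, Et; field; nonzero.
Qed.

(** * A summable majorant, uniform in the shifts *)

(** In closed form this is K^n r^(n(n-1)/2); the recursion matches that of [term]. *)
Fixpoint majorant (K r : R) (n : nat) : R :=
  match n with
  | O => 1
  | S k => majorant K r k * (K * r ^ k)
  end.

Lemma majorant_pos (K r : R) (n : nat) :
  (0 <= K)%R -> (0 <= r)%R -> (0 <= majorant K r n)%R.
Proof.
intros HK Hr; induction n as [|n IH]; simpl; [lra|].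
apply Rmult_le_pos; auto; apply Rmult_le_pos; auto; apply pow_le; auto.
Qed.

(** The ratio K r^n of consecutive terms is eventually at most 1/2, so a geometric series dominates
    from there on. *)
Lemma ex_series_majorant (K r : R) :
  (0 <= K)%R -> (0 <= r < 1)%R -> ex_series (majorant K r).
Proof.
intros HK Hr; destruct (pow_eventually_small K r (1 / 2) Hr) as [N HN]; [lra|].
apply (ex_series_incr_n _ N).
apply (@ex_series_le R_AbsRing R_CompleteNormedModule _
  (fun n => majorant K r N * (1 / 2) ^ n)%R).
- intros n; change (Rabs (majorant K r (N + n)) <= majorant K r N * (1 / 2) ^ n)%R.
  rewrite Rabs_pos_eq by (apply majorant_pos; lra).
  induction n as [|n IH]; [rewrite Nat.add_0_r; simpl; lra|].
  rewrite Nat.add_succ_r; simpl majorant.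
  replace (majorant K r N * (1 / 2) ^ S n)%R
    with (majorant K r N * (1 / 2) ^ n * (1 / 2))%R by (simpl; ring).
  apply Rmult_le_compat; auto.
  + apply majorant_pos; lra.
  + apply Rmult_le_pos; auto; apply pow_le; lra.
  + apply HN; lia.
- apply (ex_series_scal (V := R_NormedModule)), ex_series_geom.
  rewrite Rabs_pos_eq; lra.
Qed.

Lemma Cmod_div_le (z w : C) (b m : R) :
  (Cmod z <= b)%R -> (0 < m)%R -> (m <= Cmod w)%R -> (Cmod (z / w) <= b / m)%R.
Proof.
intros Hz Hm Hw; rewrite Cmod_div by (apply Cmod_gt_0; lra).
apply Rmult_le_compat; auto using Cmod_ge_0.
- left; apply Rinv_0_lt_compat; lra.
- apply Rinv_le_contravar; auto.
Qed.

Lemma Cmod_mult_le (z w : C) (b c : R) :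
  (Cmod z <= b)%R -> (Cmod w <= c)%R -> (Cmod (z * w) <= b * c)%R.
Proof. rewrite Cmod_mult; intros; apply Rmult_le_compat; auto using Cmod_ge_0. Qed.

Lemma Rmult_le_lower (a b m k : R) :
  (0 < m)%R -> (0 < k)%R -> (m <= a)%R -> (k <= b)%R -> (m * k <= a * b)%R.
Proof. intros; apply Rmult_le_compat; lra. Qed.

Lemma Cmod_pow_le_1 (q : C) (n : nat) : (Cmod q < 1)%R -> (Cmod (q ^ n) <= 1)%R.
Proof.
intros Hq; destruct n as [|n]; [simpl; rewrite Cmod_1; lra|].
left; apply Cmod_pow_lt_1, Hq.
Qed.

Lemma Cmod_1_minus_mul_le (x z : C) (B : R) :
  (Cmod x <= B)%R -> (Cmod z <= 1)%R -> (Cmod (1 - x * z) <= 1 + B)%R.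
Proof.
intros Hx Hz; eapply Rle_trans; [apply Cmod_1_minus_le|].
pose proof (Cmod_mult_le x z B 1 Hx Hz); lra.
Qed.

(** In each ratio of consecutive terms two numerator factors have modulus at most 1 + B, the power
    q^(j+1) at most |q|^j, and the denominator at least m k. Only [B] and [m] depend on [x]. *)
Lemma term_bound (q x : C) (B m k : R) (n : nat) :
  (Cmod q < 1)%R -> (Cmod x <= B)%R -> (0 < m)%R -> (0 < k)%R ->
  (forall j, (m <= Cmod (1 - x ^ 2 * q * (q ^ j) ^ 2))%R) ->
  (forall j, (k <= Cmod (1 - q ^ 3 * (q ^ j) ^ 3))%R) ->
  (Cmod (term q x n) <= majorant ((1 + B) * (1 + B) / (m * k)) (Cmod q) n)%R.
Proof.
intros Hq Hx Hm Hk Hmj Hkj; induction n as [|n IH]; cbn [term majorant].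
- rewrite Cmod_1; lra.
- apply Cmod_mult_le; auto.
  replace ((1 + B) * (1 + B) / (m * k) * Cmod q ^ n)%R
    with ((1 + B) * (1 + B) * Cmod q ^ n / (m * k))%R by (field; lra).
  apply Cmod_div_le; [|apply Rmult_lt_0_compat; auto|
    rewrite Cmod_mult; apply Rmult_le_lower; auto].
  rewrite Cmod_opp; apply Cmod_mult_le; [apply Cmod_mult_le|].
  + apply Cmod_1_minus_mul_le; auto; apply Cmod_pow_le_1, Hq.
  + rewrite <- (Cpow_mult_r q n 2), <- Cpow_add_r.
    pose proof (Cmod_triangle x (- q ^ (2 + n * 2))) as H.
    rewrite Cmod_opp in H; pose proof (Cmod_pow_le_1 q (2 + n * 2) Hq).
    unfold Cminus; lra.
  + rewrite <- (Rmult_1_l (Cmod q ^ n)), <- Cmod_pow.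
    apply Cmod_mult_le; lra.
Qed.

Lemma admissible_bounded_below (q x : C) :
  (Cmod q < 1)%R -> admissible q x ->
  exists m, (0 < m)%R /\ forall j, (m <= Cmod (1 - x ^ 2 * q * (q ^ j) ^ 2))%R.
Proof.
intros Hq Hd.
destruct (Cpow_factors_bounded_below (x ^ 2 * q) (q ^ 2)) as [m [Hm Hj]].
- apply (Cmod_pow_lt_1 q 1 Hq).
- intros j; rewrite Cpow_pow_comm; apply Hd.
- exists m; split; auto; intros j; rewrite (Cpow_pow_comm q j 2); apply Hj.
Qed.

(** One [K] serves all [N]: the shift does not increase |x|, and its denominator factor at [j] is
    that of [x] at j + 2N. *)
Lemma term_shift_bound (q x : C) :
  (Cmod q < 1)%R -> admissible q x ->
  exists K, (0 <= K)%R /\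
  forall N n, (Cmod (term q (x * (q ^ 2) ^ N) n) <= majorant K (Cmod q) n)%R.
Proof.
intros Hq Hd; destruct (admissible_bounded_below q x Hq Hd) as [m [Hm Hmj]].
destruct (Cpow_factors_bounded_below (q ^ 3) (q ^ 3)) as [k [Hk Hkj]].
{ apply (Cmod_pow_lt_1 q 2 Hq). }
{ intros j; rewrite Cpow_pow_comm; apply cube_factor_neq_1, Hq. }
exists ((1 + Cmod x) * (1 + Cmod x) / (m * k))%R; split.
- apply Rdiv_le_0_compat; [|apply Rmult_lt_0_compat; auto].
  pose proof (Cmod_ge_0 x); nra.
- intros N n; apply term_bound; auto.
  + rewrite <- (Rmult_1_r (Cmod x)), <- Cpow_mult_r.
    apply Cmod_mult_le; [lra|apply Cmod_pow_le_1, Hq].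
  + intros j.
    replace ((x * (q ^ 2) ^ N) ^ 2 * q * (q ^ j) ^ 2)
      with (x ^ 2 * q * (q ^ (j + 2 * N)) ^ 2); auto.
    rewrite Cpow_add_r, (Cpow_mult_r q 2 N); ring.
  + intros j; rewrite (Cpow_pow_comm q j 3); apply Hkj.
Qed.

(** * The sum of the series and its functional equation *)

Definition term_sum (q x : C) : C := Clim_seq (sum_n (term q x)).

Lemma term_sum_Ccvg (q x : C) :
  (Cmod q < 1)%R -> admissible q x -> Ccvg (sum_n (term q x)) (term_sum q x).
Proof.
intros Hq Hd; destruct (term_shift_bound q x Hq Hd) as [K [HK Hb]].
destruct (ex_series_Cmod (term q x) (majorant K (Cmod q))) as [l Hl].
- intros n; specialize (Hb 0%nat n).
  replace (x * (q ^ 2) ^ 0) with x in Hb by (simpl; ring); exact Hb.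
- apply ex_series_majorant; auto using Cmod_ge_0.
- unfold term_sum; rewrite (Ccvg_Clim_seq _ _ Hl); exact Hl.
Qed.

Lemma Ccvg_term_0 (q x : C) :
  (Cmod q < 1)%R -> admissible q x -> Ccvg (term q x) 0.
Proof.
intros Hq Hd; destruct (term_shift_bound q x Hq Hd) as [K [HK Hb]].
apply (Ccvg_dominated _ _ (majorant K (Cmod q))).
- intros n; specialize (Hb 0%nat n).
  replace (x * (q ^ 2) ^ 0) with x in Hb by (simpl; ring).
  replace (term q x n - 0) with (term q x n) by ring; exact Hb.
- apply ex_series_lim_0, ex_series_majorant; auto using Cmod_ge_0.
Qed.

Lemma Ccvg_0_mult_bounded (u v : nat -> C) (B : R) :
  Ccvg u 0 -> (forall n, (Cmod (v n) <= B)%R) -> Ccvg (fun n => u n * v n) 0.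
Proof.
intros Hu Hv; apply (Ccvg_dominated _ _ (fun n => Cmod (u n - 0) * B)%R).
- intros n; replace (u n * v n - 0) with ((u n - 0) * v n) by ring.
  apply Cmod_mult_le; auto; lra.
- replace (Finite 0) with (Finite (0 * B)) by (f_equal; ring).
  apply is_lim_seq_mult'; [exact Hu|apply is_lim_seq_const].
Qed.

(** Limit of [term_telescoping]: the right-hand side there is a null sequence times a bounded
    rational factor. *)
Lemma term_sum_functional_equation (q x : C) :
  (Cmod q < 1)%R -> admissible q x ->
  (1 - x ^ 2 * q) * (1 - x ^ 2 * q ^ 3) * term_sum q x
  = (1 - x * q) * (1 - x ^ 3 * q ^ 3) * term_sum q (x * q ^ 2).
Proof.
intros Hq Hd; destruct (admissible_bounded_below q x Hq Hd) as [m [Hm Hmj]].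
enough (E : (1 - x ^ 2 * q) * (1 - x ^ 2 * q ^ 3) * term_sum q x
  - (1 - x * q) * (1 - x ^ 3 * q ^ 3) * term_sum q (x * q ^ 2) = 0).
{ rewrite <- (Cplus_0_l (_ * term_sum q (x * q ^ 2))), <- E; ring. }
eapply Ccvg_unique.
- apply Ccvg_minus; (apply Ccvg_mult; [apply Ccvg_const|]);
    apply term_sum_Ccvg; auto using admissible_shift.
- eapply Ccvg_ext; [intros n; symmetry; apply term_telescoping; auto|].
  set (B := Cmod x).
  (* The constant bounds the certificate factor by factor, with the two powers of [q] bounded by
     1. *)
  apply (Ccvg_0_mult_bounded _ _ (B * (1 + B) * (1 + B) * 1 * 1 / (m * m))).
  + rewrite <- (Cmult_0_r ((1 - x ^ 2 * q) * (1 - x ^ 2 * q ^ 3))).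
    apply Ccvg_mult; [apply Ccvg_const|apply Ccvg_term_0; auto].
  + intros n; apply Cmod_div_le; [|apply Rmult_lt_0_compat; auto|
      rewrite Cmod_mult; apply Rmult_le_lower; auto].
    assert (HB : (Cmod x <= B)%R) by apply Rle_refl.
    repeat apply Cmod_mult_le; auto using Cmod_pow_le_1; try lra.
    * apply Cmod_1_minus_mul_le; auto using Cmod_pow_le_1.
    * rewrite <- Cmult_assoc, <- Cpow_add_r.
      apply Cmod_1_minus_mul_le; auto using Cmod_pow_le_1.
Qed.

(** The functional equation at x q^(2N) contributes two consecutive factors of (x^2 q; q^2) but one
    of each product on the right, hence the index 2N. *)
Lemma term_sum_iterate (q x : C) (N : nat) :
  (Cmod q < 1)%R -> admissible q x ->
  qpoch (x ^ 2 * q) (q ^ 2) (2 * N) * term_sum q x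
  = qpoch (x * q) (q ^ 2) N * qpoch (x ^ 3 * q ^ 3) (q ^ 6) N
    * term_sum q (x * (q ^ 2) ^ N).
Proof.
intros Hq Hd; induction N as [|N IH].
- simpl; replace (x * 1) with x by ring; ring.
- replace (2 * S N)%nat with (S (S (2 * N))) by lia; cbn [qpoch].
  assert (HF := term_sum_functional_equation q _ Hq (admissible_shift_n q x N Hd)).
  rewrite !(Cpow_S (q ^ 2)), (Cpow_mult_r (q ^ 2) 2 N).
  rewrite (Cpow_pow_comm (q ^ 2) 2 N).
  replace ((q ^ 6) ^ N) with (((q ^ 2) ^ N) ^ 3)
    by (rewrite (Cpow_pow_comm (q ^ 2) N 3); f_equal; ring).
  replace (x * (q ^ 2 * (q ^ 2) ^ N)) with (x * (q ^ 2) ^ N * q ^ 2) by ring.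
  set (Q := (q ^ 2) ^ N) in *.
  transitivity (qpoch (x ^ 2 * q) (q ^ 2) (2 * N) * term_sum q x *
    ((1 - (x * Q) ^ 2 * q) * (1 - (x * Q) ^ 2 * q ^ 3))); [ring|].
  rewrite IH.
  transitivity (qpoch (x * q) (q ^ 2) N * qpoch (x ^ 3 * q ^ 3) (q ^ 6) N *
    ((1 - (x * Q) ^ 2 * q) * (1 - (x * Q) ^ 2 * q ^ 3) * term_sum q (x * Q)));
    [ring|].
  rewrite HF; ring.
Qed.

(** * The limit of the iterated equation as x q^(2N) tends to 0 *)

Lemma Ccvg_shift_0 (q x : C) :
  (Cmod q < 1)%R -> Ccvg (fun N => x * (q ^ 2) ^ N) 0.
Proof.
intros Hq; rewrite <- (Cmult_0_r x); apply Ccvg_mult; [apply Ccvg_const|].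
apply (Ccvg_dominated _ _ (fun N => Cmod (q ^ 2) ^ N)%R).
- intros N; replace ((q ^ 2) ^ N - 0) with ((q ^ 2) ^ N) by ring.
  rewrite Cmod_pow; lra.
- apply is_lim_seq_geom; rewrite Rabs_pos_eq by apply Cmod_ge_0.
  apply (Cmod_pow_lt_1 q 1 Hq).
Qed.

Lemma admissible_0 (q : C) : admissible q 0.
Proof.
intros k E; apply C1_nz; rewrite <- E; ring.
Qed.

(** Each term is a rational function of [x] whose denominator does not vanish at 0. *)
Lemma Ccvg_term_shift (q x : C) (n : nat) :
  (Cmod q < 1)%R -> admissible q x ->
  Ccvg (fun N => term q (x * (q ^ 2) ^ N) n) (term q 0 n).
Proof.
intros Hq Hd; assert (Hx := Ccvg_shift_0 q x Hq).
induction n as [|n IH]; cbn [term]; [apply Ccvg_const|].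
apply Ccvg_mult; auto; apply Ccvg_mult.
- apply (Ccvg_ext (fun N => 0 - (1 - x * (q ^ 2) ^ N * q ^ n) *
    (x * (q ^ 2) ^ N - q ^ 2 * (q ^ n) ^ 2) * (q * q ^ n))); [intros; ring|].
  replace (- ((1 - 0 * q ^ n) * (0 - q ^ 2 * (q ^ n) ^ 2) * (q * q ^ n)))
    with (0 - (1 - 0 * q ^ n) * (0 - q ^ 2 * (q ^ n) ^ 2) * (q * q ^ n)) by ring.
  repeat first [exact Hx | apply Ccvg_const | apply Ccvg_minus | apply Ccvg_mult].
- apply Ccvg_inv.
  + intros N; apply Cmult_neq_0; apply neq_1_sub.
    * apply (admissible_shift_n q x N Hd).
    * apply cube_factor_neq_1, Hq.
  + apply Cmult_neq_0; apply neq_1_sub;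
      [apply (admissible_0 q)|apply cube_factor_neq_1, Hq].
  + cbn [Cpow].
    repeat first [exact Hx | apply Ccvg_const | apply Ccvg_minus | apply Ccvg_mult].
Qed.

(** Limit and sum are interchanged thanks to a majorant independent of [N]. *)
Lemma term_sum_shift_Ccvg (q x : C) :
  (Cmod q < 1)%R -> admissible q x ->
  Ccvg (fun N => term_sum q (x * (q ^ 2) ^ N)) (term_sum q 0).
Proof.
intros Hq Hd; destruct (term_shift_bound q x Hq Hd) as [K [HK Hb]].
apply (Ccvg_series_Tannery (fun N => term q (x * (q ^ 2) ^ N)) (term q 0)
  (majorant K (Cmod q))); auto.
- apply ex_series_majorant; auto using Cmod_ge_0.
- intros n; apply Ccvg_term_shift; auto.
- intros N; apply term_sum_Ccvg; auto; apply admissible_shift_n, Hd.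
- apply term_sum_Ccvg; auto; apply admissible_0.
Qed.

Lemma term_sum_product (q x : C) :
  (Cmod q < 1)%R -> admissible q x ->
  qpoch_inf (x ^ 2 * q) (q ^ 2) * term_sum q x
  = qpoch_inf (x * q) (q ^ 2) * qpoch_inf (x ^ 3 * q ^ 3) (q ^ 6) * term_sum q 0.
Proof.
intros Hq Hd.
assert (Hq2 : (Cmod (q ^ 2) < 1)%R) by apply (Cmod_pow_lt_1 q 1 Hq).
assert (Hq6 : (Cmod (q ^ 6) < 1)%R) by apply (Cmod_pow_lt_1 q 5 Hq).
eapply Ccvg_unique.
- apply Ccvg_mult; [|apply Ccvg_const].
  apply (Ccvg_subseq (qpoch (x ^ 2 * q) (q ^ 2)) _ (fun N => (2 * N)%nat)); [intros; lia|].
  apply qpoch_Ccvg, Hq2.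
- eapply Ccvg_ext; [intros N; symmetry; apply term_sum_iterate; auto|].
  repeat apply Ccvg_mult; auto using qpoch_Ccvg, term_sum_shift_Ccvg.
Qed.

(** * Evaluation at 1 and at 0, and the conclusion *)

(** The first ratio contains 1 - x q^0, which vanishes at x = 1 and kills all later terms. *)
Lemma term_sum_1 (q : C) : term_sum q 1 = 1.
Proof.
assert (H : forall n, term q 1 (S n) = 0).
{ induction n as [|n IH].
  - cbn [term Cpow]; replace (1 - 1 * 1) with (RtoC 0) by ring.
    unfold Cdiv; ring.
  - change (term q 1 (S (S n))) with (term q 1 (S n) *
      (- ((1 - 1 * q ^ S n) * (1 - q ^ 2 * (q ^ S n) ^ 2) * (q * q ^ S n)) /
         ((1 - 1 ^ 2 * q * (q ^ S n) ^ 2) * (1 - q ^ 3 * (q ^ S n) ^ 3)))).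
    rewrite IH; ring. }
apply Ccvg_Clim_seq, (Ccvg_ext (fun _ => 1)); [|apply Ccvg_const].
induction n as [|n IH]; [rewrite sum_O; reflexivity|].
rewrite sum_n_CS, <- IH, H; ring.
Qed.

(* Comparing with x = 1, where the series terminates, evaluates the sum at 0
   without Euler's identities. *)
Lemma term_sum_0 (q : C) :
  (Cmod q < 1)%R -> qpoch_inf (q ^ 3) (q ^ 6) * term_sum q 0 = 1.
Proof.
intros Hq.
assert (Hd : admissible q 1).
{ intros k; rewrite <- Cpow_mult_r, Cpow_1_l, Cmult_1_l, <- Cpow_S.
  apply Cpow_S_neq_1, Hq. }
assert (H := term_sum_product q 1 Hq Hd).
rewrite term_sum_1, !Cpow_1_l, !Cmult_1_l, Cmult_1_r, <- Cmult_assoc in H.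
(* At x = 1 both (x^2 q; q^2)_oo and (x q; q^2)_oo equal (q; q^2)_oo, which therefore cancels once
   it is nonzero. *)
assert (Hnz : qpoch_inf q (q ^ 2) <> 0).
{ apply qpoch_inf_neq_0; [apply (Cmod_pow_lt_1 q 1 Hq)|].
  intros k; rewrite <- Cpow_mult_r, <- Cpow_S; apply Cpow_S_neq_1, Hq. }
set (E := _ * term_sum q 0) in *.
replace E with (/ qpoch_inf q (q ^ 2) * (qpoch_inf q (q ^ 2) * E)) by (field; auto).
rewrite <- H; field; auto.
Qed.

Theorem theorem1p3 (q a : C)
  (hq : (Cmod q < 1)%R)
  (ha : a <> 0)
  (hden : forall k : nat, a ^ 2 * q ^ (2 * k + 1) <> 1) :
  is_series
    (fun n : nat =>
       (qpoch a q n * qpoch (/ a * q ^ 2) (q ^ 2) n)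
       / (qpoch (a ^ 2 * q) (q ^ 2) n * qpoch (q ^ 3) (q ^ 3) n)
       * (- (1)) ^ n * a ^ n * q ^ (n * (n - 1) / 2 + n))
    ((qpoch_inf (a * q) (q ^ 2) * qpoch_inf (a ^ 3 * q ^ 3) (q ^ 6))
     / (qpoch_inf (a ^ 2 * q) (q ^ 2) * qpoch_inf (q ^ 3) (q ^ 6))).
Proof.
assert (Hd : admissible q a).
{ intros k E; apply (hden k); rewrite <- E, Cpow_add_r, (Nat.mul_comm 2 k), Cpow_mult_r.
  ring. }
apply (is_series_ext (term q a)).
{ intros n; symmetry; apply term_summand; auto. }
apply Ccvg_series.
replace (_ / _) with (term_sum q a); [apply term_sum_Ccvg; auto|].
assert (H0 := term_sum_0 q hq).
assert (H := term_sum_product q a hq Hd).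
assert (H3 : qpoch_inf (a ^ 2 * q) (q ^ 2) <> 0).
{ apply qpoch_inf_neq_0; [apply (Cmod_pow_lt_1 q 1 hq)|].
  intros k; rewrite Cpow_pow_comm; apply Hd. }
(* Nonvanishing is read off from [H0], where the product with the sum at 0 equals 1. *)
assert (H4 : qpoch_inf (q ^ 3) (q ^ 6) <> 0).
{ intros E; rewrite E, Cmult_0_l in H0; apply C1_nz; auto. }
transitivity (/ qpoch_inf (a ^ 2 * q) (q ^ 2) *
  (qpoch_inf (a ^ 2 * q) (q ^ 2) * term_sum q a)); [field; auto|].
rewrite H.
transitivity (qpoch_inf (a * q) (q ^ 2) * qpoch_inf (a ^ 3 * q ^ 3) (q ^ 6)
  / (qpoch_inf (a ^ 2 * q) (q ^ 2) * qpoch_inf (q ^ 3) (q ^ 6)) *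
  (qpoch_inf (q ^ 3) (q ^ 6) * term_sum q 0)); [field; auto|].
rewrite H0; ring.
Qed.
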